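(* Let $A>0$, $B>0$ be real constants, let $\mathbf{h}\in\mathbb{C}^{1\times N_T}$, and let $\lambda\ge 0$ and $\theta\in(0,1)$ be given. Then the optimal solution of the follower-level problem $$\max_{P_{BS}\ge 0}\; U_{BS}(P_{BS})=\lambda\theta P_{BS}\|\mathbf{h}\|^{2}-\theta\left(AP_{BS}^{2}+BP_{BS}\right)$$ is $$P_{BS}^{\mathrm{opt}}=\left[\frac{\lambda\|\mathbf{h}\|^{2}-B}{2A}\right]^{+}.$$
   Context: $[x]^{+}=\max\{x,0\}$ and $\|\cdot\|$ is the Euclidean norm. Interpretation: a base station (follower) with channel vector $\mathbf{h}$ to a device transmitter chooses its transmit power $P_{BS}$ to maximize its profit, given the energy price $\lambda$ and the energy transfer time fraction $\theta$; $AP_{BS}^2+BP_{BS}$ is its energy cost per unit time. *)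

(* Defs.v *)
From mathcomp Require Import all_boot all_order all_algebra.
From mathcomp Require Import classical_sets reals.
From mathcomp.real_closed Require Import complex.
Set Implicit Arguments.
Unset Strict Implicit.
Unset Printing Implicit Defensive.
Import Order.TTheory GRing.Theory Num.Theory.
Local Open Scope ring_scope.
Local Open Scope complex_scope.

(* MathComp-Analysis norms matrices by the sup norm, hence this definition.
   [Normc.normc z : R] is the modulus of [z : R[i]]; [`|z|] lives in [R[i]]. *)
Definition enorm (R : realType) (n : nat) (h : 'rV[R[i]]_n) : R :=
  Num.sqrt (\sum_(j < n) Normc.normc (h 0 j) ^+ 2).

Definition pos_part (R : realType) (x : R) : R := Num.max x 0.

Definition maximizer (R : realType) (T : Type) (D : set T) (f : T -> R)
    (x : T) : Prop :=
  D x /\ forall y : T, D y -> f y <= f x.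

Definition U_BS (R : realType) (N_T : nat) (A B : R) (h : 'rV[R[i]]_N_T)
    (lambda theta P : R) : R :=
  lambda * theta * P * enorm h ^+ 2 - theta * (A * P ^+ 2 + B * P).

(* Main.v *)
Require Import Defs.
From mathcomp Require Import all_boot all_order all_algebra.
From mathcomp Require Import classical_sets reals.
From mathcomp.real_closed Require Import complex.
From mathcomp Require Import ring lra.
Import Order.TTheory GRing.Theory Num.Theory.
Local Open Scope ring_scope.
Local Open Scope complex_scope.
Local Open Scope classical_set_scope.

(** Completing the square, [U_BS P] is a constant minus [theta * A * (P - m)^2]
    where [m = (lambda * |h|^2 - B) / (2 * A)].  Maximizing it over [P >= 0]
    thus amounts to projecting [m] onto the half-line, and the projection is
    [pos_part m]. *)

Lemma pos_part_ge0 (R : realType) (m : R) : 0 <= pos_part m.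
Proof. by rewrite /pos_part le_max lexx orbT. Qed.

(* The obtuse-angle property of the projection onto a convex set; it gives
   both minimality of the distance and uniqueness of the minimizer. *)
Lemma pos_part_projection (R : realType) (m y : R) : 0 <= y ->
  (pos_part m - m) ^+ 2 + (y - pos_part m) ^+ 2 <= (y - m) ^+ 2.
Proof. by move=> y0; rewrite /pos_part; case: (leP m 0) => m0; nra. Qed.

Lemma U_BS_square (R : realType) (n : nat) (A B : R) (h : 'rV[R[i]]_n)
    (lambda theta P : R) : A != 0 ->
  let m := (lambda * enorm h ^+ 2 - B) / (2 * A) in
  U_BS A B h lambda theta P = theta * A * (m ^+ 2 - (P - m) ^+ 2).
Proof. by move=> A0 /=; rewrite /U_BS; field. Qed.

(** In the completed square the term [m ^+ 2] cancels and the factor [theta * A] is positive, so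
    maximizing [U_BS] means minimizing the distance to [m]. *)
Lemma U_BS_le (R : realType) (n : nat) (A B : R) (h : 'rV[R[i]]_n)
    (lambda theta P Q : R) : 0 < A -> 0 < theta ->
  let m := (lambda * enorm h ^+ 2 - B) / (2 * A) in
  (U_BS A B h lambda theta Q <= U_BS A B h lambda theta P) =
  ((P - m) ^+ 2 <= (Q - m) ^+ 2).
Proof.
move=> A0 t0 m; rewrite !U_BS_square ?gt_eqF// -/m.
by rewrite ler_pM2l ?mulr_gt0// lerD2l lerN2.
Qed.

Theorem lemma1 (R : realType) (N_T : nat) (A B : R) (h : 'rV[R[i]]_N_T)
    (lambda theta : R) (hA : 0 < A) (hB : 0 < B) (hlambda : 0 <= lambda)
    (htheta0 : 0 < theta) (htheta1 : theta < 1) :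
  forall P : R,
    maximizer [set Q : R | 0 <= Q] (U_BS A B h lambda theta) P <->
    P = pos_part ((lambda * enorm h ^+ 2 - B) / (2 * A)).
Proof.
move=> P; set m := (_ / _); split=> [[/= P0 maxP]|->].
- have := maxP _ (pos_part_ge0 _ m); rewrite U_BS_le// -/m => leP.
  have proj := pos_part_projection _ m _ P0.
  (* With [p = pos_part m], [proj] and [leP] chain to [(p - m)^2 + (P - p)^2 <= (P - m)^2 <= (p -
     m)^2], which forces [(P - p)^2 <= 0]. *)
  apply/eqP; rewrite -subr_eq0 -sqrf_eq0 eq_le sqr_ge0 andbT.
  by rewrite -(lerD2l ((pos_part m - m) ^+ 2)) addr0 (le_trans proj).
- split=> [|y /= y0]; first exact: pos_part_ge0.
  (* Minimality: drop the square [(y - pos_part m)^2] from the projection inequality. *)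
  rewrite U_BS_le// -/m (le_trans _ (pos_part_projection _ m _ y0))//.
  by rewrite lerDl sqr_ge0.
Qed.
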